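(* For every integer $k\ge1$ there is a constant $C_k>0$, depending only on $k$, such that for all integers $B\ge2$, $$N_k(B)\le C_k\,B^{k+1}(\log B)^{k^2+2k-2},$$ where $N_k(B)$ denotes the number of solutions of the equation $n_1n_2\cdots n_{k+1}=n_{k+2}n_{k+3}\cdots n_{2(k+1)}$ in integers $n_i$ with $1\le n_i\le B$ for $1\le i\le 2(k+1)$. *)

(* Defs.v *)
From HB Require Import structures.
From mathcomp Require Import all_boot all_order all_algebra.

Set Implicit Arguments.
Unset Strict Implicit.
Unset Printing Implicit Defensive.

(* The variables n_1, ..., n_{2(k+1)} are indexed from 0, so the left-hand
   product runs over the indices i < k + 1.  Each n_i is taken in
   {0, ..., B} = 'I_B.+1, the value 0 being excluded explicitly. *)
Definition mult_solutions (k B : nat) :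
    {set {ffun 'I_(2 * k.+1) -> 'I_B.+1}} :=
  [set n : {ffun 'I_(2 * k.+1) -> 'I_B.+1} |
    [forall i, 1 <= n i <= B] &&
    (\prod_(i < 2 * k.+1 | i < k.+1) (n i : nat) ==
     \prod_(i < 2 * k.+1 | k.+1 <= i) (n i : nat))].

Definition num_mult_solutions (k B : nat) : nat := #|mult_solutions k B|.

(* Main.v *)
Require Import Defs.
From mathcomp Require Import all_boot all_order all_algebra.
From mathcomp Require Import all_classical all_reals all_analysis.
From mathcomp Require Import ring lra.

Import Order.TTheory GRing.Theory Num.Theory.

(** Write r = k + 1.  Two factorizations of the same integer into r factors
    have a common refinement: an r x r matrix of positive integers whose row
    products are the n_i with i <= r and whose column products are the n_i
    with i > r.  So N_k(B) is at most the number of such matrices with all row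
    and column products at most B.  Let H be the sum of 1/a for a <= B, so that
    H << log B.

    Using the rows only, each row has at most B H^(r-1) values, which gives
    B^r H^(r(r-1)); for k >= 2 this suffices because
    k(k+1) <= k^2 + 2k - 2.  For k = 1 it loses one logarithm: there, with
    off-diagonal entries b and c, the row and column conditions together
    bound both diagonal entries by B / max(b, c), and the sum of
    1 / max(b, c)^2 over b, c <= B is at most 2H. *)

(** * Common refinement of two factorizations *)

(** Peel off [g], the gcd of [a] and [m 0]: the quotient [a %/ g] is coprime to [m 0 %/ g], so by
    Gauss it divides the product of the remaining [m j], and induction applies. *)
Lemma dvdn_prod_split (s a : nat) (m : nat -> nat) :
    (0 < a)%N -> a %| \prod_(0 <= j < s) m j ->
  exists e : nat -> nat,
    (forall j, (j < s)%N -> e j %| m j) /\ a = \prod_(0 <= j < s) e j.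
Proof.
elim: s a m => [|s IHs] a m a_gt0.
  by rewrite big_nil dvdn1 => /eqP ->; exists id; rewrite big_nil.
rewrite big_nat_recl //; set g := gcdn a (m 0%N) => a_dvd.
have g_gt0 : (0 < g)%N by rewrite gcdn_gt0 a_gt0.
have aE : a = (a %/ g * g)%N by rewrite divnK // dvdn_gcdl.
have /IHs[] : a %/ g %| \prod_(0 <= j < s) m j.+1.
  have: coprime (a %/ g) (m 0%N %/ g).
    rewrite /coprime -(eqn_pmul2r g_gt0) muln_gcdl -aE divnK ?dvdn_gcdr //.
    by rewrite mul1n.
  move=> /Gauss_dvdr <-; rewrite -(dvdn_pmul2r g_gt0) -aE.
  by rewrite mulnAC divnK ?dvdn_gcdr.
- by rewrite divn_gt0 // dvdn_leq // dvdn_gcdl.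
move=> e [e_dvd e_prod].
exists (fun j => if j is j'.+1 then e j' else g); split.
  by case=> [|j] lt_js; [exact: dvdn_gcdr | exact: e_dvd].
by rewrite big_nat_recl // -e_prod mulnC.
Qed.

(** Induction on the number of rows. Since [n 0] divides the product of the [m j], it splits into
    divisors [e j] of the [m j]; these form the first row, and the other rows refine the quotients
    [m j %/ e j]. *)
Lemma eq_prod_factor_matrix (r s : nat) (n m : nat -> nat) :
    (forall i, (i < r)%N -> (0 < n i)%N) ->
    (forall j, (j < s)%N -> (0 < m j)%N) ->
    \prod_(0 <= i < r) n i = \prod_(0 <= j < s) m j ->
  exists d : nat -> nat -> nat,
    (forall i, (i < r)%N -> n i = \prod_(0 <= j < s) d i j) /\
    (forall j, (j < s)%N -> m j = \prod_(0 <= i < r) d i j).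
Proof.
elim: r n m => [|r IHr] n m n_gt0 m_gt0.
  rewrite big_nil => /esym/eqP.
  rewrite prod_nat_seq_eq1 => /allP m1; exists (fun _ _ => 1%N); split=> // j lt_js.
  by rewrite big_nil; apply/eqP/m1; rewrite mem_index_iota.
rewrite big_nat_recl // => nmE.
have n0_gt0 : (0 < n 0%N)%N by exact: n_gt0.
have [|e [e_dvd n0E]] := @dvdn_prod_split s (n 0%N) m n0_gt0.
  by rewrite -nmE dvdn_mulr.
have [|j lt_js||d [dn dm]] := IHr (fun i => n i.+1) (fun j => m j %/ e j).
- by move=> i lt_ir; apply: n_gt0.
- have mj_gt0 := m_gt0 j lt_js; have ej_dvd := e_dvd j lt_js.
  by rewrite divn_gt0 ?(dvdn_leq mj_gt0) // (dvdn_gt0 mj_gt0).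
- apply/eqP; rewrite -(eqn_pmul2l n0_gt0) nmE {1}n0E -big_split /=.
  by apply/eqP/eq_big_nat => j /andP[_ /e_dvd e_dvdj]; rewrite mulnC divnK.
exists (fun i => if i is i'.+1 then d i' else e); split.
  by case=> [|i] // lt_ir; apply: dn.
by move=> j lt_js; rewrite big_nat_recl // -dm // mulnC divnK ?e_dvd.
Qed.

(** Curried, so that a matrix is a function from row indices to rows and rows can be counted
    independently. *)
Definition factor_matrices (r B : nat) :
    {set {ffun 'I_r -> {ffun 'I_r -> 'I_B.+1}}} :=
  [set d : {ffun 'I_r -> {ffun 'I_r -> 'I_B.+1}} |
         [&& [forall i, forall j, (0 < d i j)%N],
             [forall i, (\prod_j (d i j : nat) <= B)%N] &
             [forall j, (\prod_i (d i j : nat) <= B)%N]]].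

Lemma leq_num_mult_solutions (k B : nat) :
  (num_mult_solutions k B <= #|factor_matrices k.+1 B|)%N.
Proof.
(* [phi] lists row products, then column products. [inord] sends values above [B] to 0, but the
   matrices used below have all products at most [B]. It remains to see that [phi] reaches every
   solution. *)
pose phi (d : {ffun 'I_k.+1 -> {ffun 'I_k.+1 -> 'I_B.+1}}) :=
  [ffun i : 'I_(2 * k.+1) => inord (if (i < k.+1)%N
     then \prod_j (d (inord i) j : nat)
     else \prod_j (d j (inord (i - k.+1)) : nat)) : 'I_B.+1].
apply: leq_trans (leq_imset_card phi _); apply/subset_leq_card/fintype.subsetP => n.
rewrite inE => /andP[/forallP n_bd].
(* [g] extends [n] by 0 to all naturals, so that index ranges can be shifted freely. *)
pose g x : nat := oapp (fun i => n i : nat) 0%N (insub x).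
have gE i : n i = g i :> nat by rewrite /g valK.
rewrite (eq_bigr (fun i : 'I__ => g i)); last by move=> i _; exact: gE.
rewrite [X in _ == X](eq_bigr (fun i : 'I__ => g i)); last by move=> i _; exact: gE.
rewrite -(big_mkord (fun i => i < k.+1)%N) -(big_mkord (fun i => k.+1 <= i)%N).
rewrite -(big_nat_widen 0 k.+1 (2 * k.+1) predT) ?leq_pmull //.
rewrite -(big_nat_widenl k.+1 0 (2 * k.+1) predT) //.
have -> : \prod_(k.+1 <= i < 2 * k.+1) g i = \prod_(0 <= i < k.+1) g (i + k.+1)%N.
  by rewrite -[X in index_iota X]add0n big_addn mul2n -addnn addnK.
move=> /eqP gprod.
have g_bd i : (i < k.+1 + k.+1)%N -> (0 < g i <= B)%N.
  rewrite addnn -mul2n => lti; rewrite -[i]/(val (Ordinal lti)) -gE; exact: n_bd.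
have g1_bd i : (i < k.+1)%N -> (0 < g i <= B)%N.
  by move=> lti; apply: g_bd; apply: ltn_addl.
have g2_bd i : (i < k.+1)%N -> (0 < g (i + k.+1)%N <= B)%N.
  by move=> lti; apply: g_bd; rewrite ltn_add2r.
have [i /g1_bd/andP[]|j /g2_bd/andP[]|d [dn dm]] // :=
  @eq_prod_factor_matrix _ _ g (fun j => g (j + k.+1)%N) _ _ gprod.
pose D := [ffun i : 'I_k.+1 => [ffun j : 'I_k.+1 => inord (d i j) : 'I_B.+1]].
have d_dvd (i j : 'I_k.+1) : d i j %| g i.
  by rewrite dn // big_mkord (bigD1 j) //= dvdn_mulr.
have DE (i j : 'I_k.+1) : D i j = d i j :> nat.
  rewrite !ffunE inordK // ltnS; have /andP[gi_gt0 gi_le] := g1_bd _ (ltn_ord i).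
  exact: leq_trans (dvdn_leq gi_gt0 (d_dvd i j)) gi_le.
have rowE (i : 'I_k.+1) : \prod_j (D i j : nat) = g i.
  by rewrite dn // big_mkord; apply: eq_bigr => j _; rewrite DE.
have colE (j : 'I_k.+1) : \prod_i (D i j : nat) = g (j + k.+1)%N.
  by rewrite dm // big_mkord; apply: eq_bigr => i _; rewrite DE.
apply/imsetP; exists D.
  rewrite inE; apply/and3P; split; apply/forallP => i.
  - apply/forallP => j; rewrite DE; have /andP[gi_gt0 _] := g1_bd _ (ltn_ord i).
    exact: dvdn_gt0 gi_gt0 (d_dvd i j).
  - by rewrite rowE; have /andP[] := g1_bd _ (ltn_ord i).
  - by rewrite colE; have /andP[] := g2_bd _ (ltn_ord i).
apply/ffunP => i; apply/val_inj; rewrite /= gE ffunE.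
have /andP[_ gi_le] : (0 < g i <= B)%N by rewrite -gE; exact: n_bd.
have [lti|lei] := ltnP i k.+1.
  by rewrite rowE inordK ?inordK.
rewrite colE (@inordK k) ?subnK ?inordK //.
by rewrite ltn_subLR // addnn -mul2n.
Qed.

(** * Counting by rows *)

Lemma card_ord_pos_leq (M n : nat) :
  (#|[set a : 'I_M.+1 | (0 < a <= n)%N]| <= n)%N.
Proof.
rewrite cardE -(size_map val) -[leqRHS](size_iota 1).
apply: uniq_leq_size; first by rewrite map_inj_uniq ?enum_uniq //; exact: val_inj.
by move=> _ /mapP[a + ->]; rewrite mem_enum inE mem_iota add1n ltnS.
Qed.

Local Open Scope ring_scope.

Definition harmonic_sum (R : realType) (B : nat) : R :=
  \sum_(a : 'I_B.+1 | (0 < a)%N) (a%:R)^-1.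

Lemma natr_divn_le (R : realType) (m d : nat) : (m %/ d)%:R <= m%:R / d%:R :> R.
Proof.
have [->|d_gt0] := posnP d; first by rewrite divn0 invr0 mulr0.
by rewrite ler_pdivlMr ?ltr0n // -natrM ler_nat leq_trunc_div.
Qed.

(** Once the last [r] entries are fixed, the first is at most [B] divided by their product; the sum
    of the reciprocal products over all tails factors as the [r]-th power of [harmonic_sum]. *)
Lemma card_pos_prod_le (R : realType) (r B : nat) :
  (#|[set d : {ffun 'I_r.+1 -> 'I_B.+1} |
      [forall j, (0 < d j)%N] && (\prod_j (d j : nat) <= B)%N]|)%:R
    <= B%:R * harmonic_sum R B ^+ r.
Proof.
set S := [set d | _].
pose tl (d : {ffun 'I_r.+1 -> 'I_B.+1}) :=
  [ffun j : 'I_r => d (lift ord0 j)] : {ffun 'I_r -> 'I_B.+1}.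
pose pos := [pred a : 'I_B.+1 | (0 < a)%N].
rewrite -sum1_card (partition_big tl (mem (ffun_on pos))) /=; last first.
  move=> d; rewrite inE => /andP[/forallP d_gt0 _].
  by apply/ffun_onP => j; rewrite inE ffunE.
have -> : harmonic_sum R B ^+ r =
    \sum_(e in ffun_on pos) \prod_(j < r) ((e j)%:R : R)^-1.
  rewrite -(bigA_distr_big _ (fun (_ : 'I_r) (a : 'I_B.+1) => (a%:R : R)^-1)).
  by rewrite prodr_const card_ord.
rewrite natr_sum mulr_sumr; apply: ler_sum => e _.
rewrite sum1_card prodfV -natr_prod.
apply: le_trans (natr_divn_le R _ _); rewrite ler_nat.
apply: leq_trans (card_ord_pos_leq B _).
rewrite -[leqRHS]/(#|_|).
(* Within a fibre of [tl], a tuple is determined by its first entry. *)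
rewrite -(@card_in_imset _ _ (fun d : {ffun 'I_r.+1 -> 'I_B.+1} => d ord0)); last first.
  move=> d d' /andP[_ /eqP dE] /andP[_ /eqP d'E] d0E; apply/ffunP => j.
  case: (unliftP ord0 j) => [i|] -> //.
  by move: dE; rewrite -d'E => /ffunP/(_ i); rewrite !ffunE.
apply/subset_leq_card/fintype.subsetP => _ /imsetP[d /andP[+ /eqP <-] ->].
rewrite !inE => /andP[/forallP d_gt0]; rewrite d_gt0 /= big_ord_recl => d_le.
rewrite leq_divRL; last by apply: prodn_gt0 => j; rewrite ffunE.
by congr (_ * _ <= _)%N: d_le; apply: eq_bigr => j _; rewrite ffunE.
Qed.

Lemma card_factor_matrices_le (R : realType) (k B : nat) :
  (#|factor_matrices k.+1 B|)%:R <= (B%:R * harmonic_sum R B ^+ k) ^+ k.+1.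
Proof.
set S := [set d : {ffun 'I_k.+1 -> 'I_B.+1} |
      [forall j, (0 < d j)%N] && (\prod_j (d j : nat) <= B)%N].
apply: (@le_trans _ _ ((#|S| ^ k.+1)%:R)); last first.
  by rewrite natrX lerXn2r ?nnegrE ?card_pos_prod_le //
             (le_trans _ (card_pos_prod_le _ _ _)).
rewrite ler_nat -[X in (_ <= _ ^ X)%N](card_ord k.+1) -card_ffun_on.
apply/subset_leq_card/fintype.subsetP => d; rewrite inE => /and3P[/forallP d_gt0 /forallP d_le _].
by apply/ffun_onP => i; rewrite inE d_gt0 d_le.
Qed.

(** * The 2 x 2 case *)

(** For fixed [b] there are at most [b] values [c <= b], each contributing [1 / b^2], hence [1 / b]
    in total. The pairs with [b <= c] are symmetric; counting the diagonal twice only enlarges the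
    bound. *)
Lemma sum_maxn_invsq (R : realType) (B : nat) :
  \sum_(p : 'I_B.+1 * 'I_B.+1 | (0 < p.1)%N && (0 < p.2)%N)
     ((maxn p.1 p.2)%:R ^+ 2)^-1 <= 2 * harmonic_sum R B.
Proof.
rewrite -(pair_big (fun b : 'I_B.+1 => 0 < b)%N (fun c : 'I_B.+1 => 0 < c)%N
  (fun b c => ((maxn b c)%:R ^+ 2)^-1 : R)) /=.
have half : \sum_(b : 'I_B.+1 | (0 < b)%N)
    \sum_(c : 'I_B.+1 | (0 < c)%N) (if (c <= b)%N then (b%:R ^+ 2)^-1 else 0)
      <= harmonic_sum R B.
  apply: ler_sum => b b_gt0; rewrite -big_mkcondr sumr_const -[_ *+ #|_|]mulr_natl.
  have b_neq0 : b%:R != 0 :> R by rewrite pnatr_eq0 -lt0n.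
  have -> : (b%:R)^-1 = b%:R * (b%:R ^+ 2)^-1 :> R by field.
  rewrite ler_wpM2r ?invr_ge0 ?exprn_ge0 // ler_nat.
  by apply: leq_trans (card_ord_pos_leq B b); rewrite cardsE.
rewrite mulr2n mulrDl mul1r; apply: le_trans (lerD half half).
rewrite [X in _ <= _ + X]exchange_big -big_split /=.
apply: ler_sum => b _; rewrite -big_split /=; apply: ler_sum => c _.
have [lt_cb|lt_bc|->] := ltngtP b c; by rewrite ?addr0 ?add0r // lerDl invr_ge0 exprn_ge0.
Qed.

Lemma card_factor_matrices2_le (R : realType) (B : nat) :
  (#|factor_matrices 2 B|)%:R <= 2 * (B%:R ^+ 2 * harmonic_sum R B).
Proof.
pose off (d : {ffun 'I_2 -> {ffun 'I_2 -> 'I_B.+1}}) :=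
  (d ord0 ord_max, d ord_max ord0).
rewrite -sum1_card (partition_big off
  (fun p => (0 < p.1)%N && (0 < p.2)%N)) /=; last first.
  move=> d; rewrite inE => /and3P[/forallP d_gt0 _ _].
  by rewrite /off /= !(forallP (d_gt0 _)).
rewrite mulrCA; apply: le_trans (ler_wpM2l _ (sum_maxn_invsq R B)); last exact: exprn_ge0.
rewrite natr_sum mulr_sumr; apply: ler_sum => p /andP[p1_gt0 p2_gt0].
set m := maxn _ _; have m_gt0 : (0 < m)%N by rewrite leq_max p1_gt0.
pose A := [set a : 'I_B.+1 | (0 < a <= B %/ m)%N].
rewrite sum1_card -exprVn -exprMn.
apply: (@le_trans _ _ ((B %/ m)%:R ^+ 2)); last first.
  by rewrite lerXn2r ?nnegrE ?natr_divn_le // divr_ge0.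
rewrite -natrX ler_nat -[(_ ^ 2)%N]mulnn.
apply: leq_trans (leq_mul (card_ord_pos_leq B _) (card_ord_pos_leq B _)).
rewrite -cardsX -/A.
rewrite -(@card_in_imset _ _ (fun d : {ffun 'I_2 -> {ffun 'I_2 -> 'I_B.+1}} =>
  (d ord0 ord0, d ord_max ord_max))); last first.
  move=> d d' /andP[_ /eqP dE] /andP[_ /eqP d'E] [d00 d11].
  move: dE; rewrite -d'E => -[d01 d10].
  have I2 (i : 'I_2) : i = ord0 \/ i = ord_max.
    by case: i => [[|[|//]] lti]; [left|right]; apply/val_inj.
  by apply/ffunP => i; apply/ffunP => j; case: (I2 i) (I2 j) => -> [] ->.
apply/subset_leq_card/fintype.subsetP => _ /imsetP[d /andP[+ /eqP pE] ->].
rewrite !inE => /and3P[/forallP d_gt0 /forallP d_row /forallP d_col].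
(* Bounding both diagonal entries by [B %/ m] unfolds into four inequalities, one for each row and
   each column. *)
rewrite !(forallP (d_gt0 _)) /= !leq_divRL // /m -pE /= !maxnMr !geq_max.
have two (F : 'I_2 -> nat) : \prod_j F j = (F ord0 * F ord_max)%N.
  by rewrite big_ord_recl big_ord1; congr (_ * F _)%N; apply/val_inj.
have := d_row ord0; have := d_row ord_max; have := d_col ord0; have := d_col ord_max.
rewrite !two ![(d ord_max ord_max * _)%N]mulnC => -> -> -> ->.
by [].
Qed.

(** * Logarithmic bound and conclusion *)

Lemma harmonic_sum_le (R : realType) (B : nat) : (0 < B)%N ->
  harmonic_sum R B <= 1 + ln B%:R.
Proof.
case: B => // n _; rewrite /harmonic_sum big_mkcond big_ord_recl /= add0r.
elim: n => [|n IHn]; first by rewrite big_ord1 ln1 addr0 invr1.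
rewrite big_ord_recr /=.
have n2_gt0 : 0 < n.+2%:R :> R by rewrite ltr0n.
(* This form allows [ln (1 + x) <= x] at [x = - 1 / (n + 2)], which bounds the new term by the
   increment of [ln]. *)
have n1E : n.+1%:R = n.+2%:R * (1 + - n.+2%:R^-1) :> R.
  by rewrite mulrDr mulr1 mulrN divff ?gt_eqF // -[in RHS]natr1 addrK.
have n2V_lt1 : n.+2%:R^-1 < 1 :> R by rewrite invf_lt1 ?ltr1n.
have ln_step : ln n.+1%:R <= ln n.+2%:R - n.+2%:R^-1 :> R.
  rewrite [in leLHS]n1E lnM ?posrE ?subr_gt0 // lerD2l.
  by rewrite le_ln1Dx // ltrN2.
by apply: le_trans (lerD IHn (lexx _)) _; rewrite -addrA lerD2l -lerBrDr.
Qed.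

Theorem mainTheorem4 (R : realType) (k : nat) (hk : (1 <= k)%N) :
  exists C : R, 0 < C /\
    forall B : nat, (2 <= B)%N ->
      (num_mult_solutions k B)%:R <=
        C * B%:R ^+ (k + 1) * ln (B%:R : R) ^+ (k ^ 2 + 2 * k - 2).
Proof.
have ln2_gt0 : 0 < ln 2 :> R by rewrite ln_gt0 // ltr1n.
(* As [1 <= ln B / ln 2] for [B >= 2], this [c] absorbs the constant in [1 + ln B]. The factor 2 in
   the witness below comes from the case [k = 1]. *)
pose c : R := 1 + (ln 2)^-1.
have c_gt0 : 0 < c by rewrite addr_gt0 // invr_gt0.
exists (2 * c ^+ (k ^ 2 + 2 * k - 2)); split; first by rewrite mulr_gt0 ?exprn_gt0.
move=> B B_ge2.
have ln2_le : ln 2 <= ln B%:R :> R.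
  by rewrite ler_ln ?posrE ?ltr0n ?ler_nat // (leq_trans _ B_ge2).
have cln_ge : 1 + ln B%:R <= c * ln B%:R.
  by rewrite mulrDl mul1r addrC lerD2l mulrC ler_pdivlMr // mul1r.
have H_le : harmonic_sum R B <= c * ln B%:R.
  by apply: le_trans cln_ge; apply: harmonic_sum_le; apply: leq_trans B_ge2.
have cln_ge1 : 1 <= c * ln B%:R by apply: le_trans cln_ge; lra.
have H_ge0 : 0 <= harmonic_sum R B by apply: sumr_ge0 => a _; rewrite invr_ge0.
rewrite mulrAC -[2 * _ * _]mulrA -exprMn addn1.
apply: (@le_trans _ _ (#|factor_matrices k.+1 B|)%:R).
  by rewrite ler_nat leq_num_mult_solutions.
have [->|k_neq1] := eqVneq k 1%N.
  apply: le_trans (card_factor_matrices2_le R B) _.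
  rewrite -mulrA ler_pM2l // mulrC ler_wpM2r ?exprn_ge0 //.
have k_gt1 : (1 < k)%N by rewrite ltn_neqAle eq_sym k_neq1.
apply: le_trans (card_factor_matrices_le R k B) _.
rewrite [leLHS]exprMn [leLHS]mulrC ler_wpM2r ?exprn_ge0 // -exprM.
apply: (@le_trans _ _ ((c * ln B%:R) ^+ (k ^ 2 + 2 * k - 2))); last first.
  by rewrite ler_peMl ?ler1n // exprn_ge0 // (le_trans ler01).
apply: (@le_trans _ _ ((c * ln B%:R) ^+ (k * k.+1))).
  by rewrite lerXn2r // nnegrE (le_trans ler01).
(* Since [c * ln B] is at least 1, its exponent may grow from [k (k + 1)] to [k^2 + 2k - 2]; the
   comparison amounts to [2 <= k]. *)
rewrite ler_weXn2l //.
by rewrite mulnS -mulnn addnC -addnBA ?leq_add2l ?mul2n -?addnn -?addnBA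
           ?leq_addr // (leq_trans k_gt1) ?leq_addr.
Qed.
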